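(* Let $t(n,k)$ be the central factorial numbers of the first kind, defined for $n\ge1$ by $$x\left(x+\tfrac{n}{2}-1\right)\left(x+\tfrac{n}{2}-2\right)\cdots\left(x-\tfrac{n}{2}+1\right)=\sum_{k\ge0}t(n,k)x^k,$$ where the left side is $x\prod_{i=1}^{n-1}\left(x+\frac n2-i\right)$. Let $\Delta(x,k)$ be the polynomials defined by $\Delta(x,0)=1$ and $$\Delta(x,k+1)=(x+1)(2x+1)\Delta(x+1,k)-x^2\Delta(x,k)\quad(k\ge0).$$ Then for every non-negative integer $n$ and every complex number $x$, $$\sum_{j=0}^n(-4)^{n-j}\,t(2n+1,2j+1)\,\Delta(x,j)=(x+1)(x+2)\cdots(x+2n).$$
   Context: For $n=0$ the right-hand side is the empty product $1$. *)

(* Defs.v *)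
From mathcomp Require Import all_boot all_order all_algebra.
From mathcomp Require Import reals complex.
Set Implicit Arguments.
Unset Strict Implicit.
Unset Printing Implicit Defensive.
Import GRing.Theory Num.Theory.
Local Open Scope ring_scope.

(* Defined for n >= 1 only: at n = 0 this is 'X, not the conventional 1. *)
Definition central_factorial_poly (F : numFieldType) (n : nat) : {poly F} :=
  'X * \prod_(1 <= i < n) ('X + (n%:R / 2%:R - i%:R)%:P).

Definition central_factorial (F : numFieldType) (n k : nat) : F :=
  (central_factorial_poly F n)`_k.

Fixpoint Delta (F : numFieldType) (k : nat) : {poly F} :=
  if k is k'.+1 then
    ('X + 1) * (2%:R *: 'X + 1) * (Delta F k' \Po ('X + 1))
      - 'X ^+ 2 * Delta F k'
  else 1.

(* Main.v *)
Require Import Defs.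
From mathcomp Require Import all_boot all_order all_algebra.
From mathcomp Require Import reals complex.
From mathcomp Require Import ring zify.
Set Implicit Arguments.
Unset Strict Implicit.
Unset Printing Implicit Defensive.
Import GRing.Theory Num.Theory.
Local Open Scope ring_scope.

(** Let [T f = (x+1)(2x+1) f(x+1) - x^2 f(x)], so that [Delta j = T^j 1]. After
    rescaling, the odd central factorial polynomial of index [2n+1] becomes
    [p_n(y) = (y + 1^2)(y + 3^2) ... (y + (2n-1)^2)] and the left-hand side is
    [p_n(T) 1]. With [P_n = (x+1) ... (x+2n)], a direct computation gives
    [(T + (2n+1)^2) P_n = P_(n+1)], and induction on [n] concludes. *)

Section Rescaled.
Variable F : numFieldType.

Definition odd_square_poly (n : nat) : {poly F} :=
  \prod_(0 <= k < n) ('X + ((2 * k + 1)%:R ^+ 2)%:P).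

Lemma odd_square_polyS n :
  odd_square_poly n.+1 = odd_square_poly n * ('X + ((2 * n + 1)%:R ^+ 2)%:P).
Proof. by rewrite /odd_square_poly big_nat_recr. Qed.

Lemma size_odd_square_poly n : (size (odd_square_poly n) <= n.+1)%N.
Proof.
elim: n => [|n IHn]; first by rewrite /odd_square_poly big_nil size_poly1.
rewrite odd_square_polyS; apply: leq_trans (size_polyMleq _ _) _.
by rewrite size_XaddC addn2.
Qed.

Definition rising_poly (n : nat) : {poly F} :=
  \prod_(1 <= i < n.+1) ('X + i%:R%:P).

Lemma rising_polyS n : rising_poly n.+1 = rising_poly n * ('X + n.+1%:R%:P).
Proof. by rewrite /rising_poly big_nat_recr. Qed.

(** This absorbs the factor ['X + 1] of [Delta_step], so that [Delta_step] maps a rising product to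
    a multiple of itself. *)
Lemma rising_poly_shift n :
  ('X + 1) * (rising_poly n \Po ('X + 1)) = rising_poly n.+1.
Proof.
elim: n => [|n IHn].
  by rewrite rising_polyS /rising_poly big_geq // comp_polyC mul1r mulr1.
rewrite rising_polyS comp_polyM mulrA IHn [RHS]rising_polyS; congr (_ * _).
by rewrite comp_polyD comp_polyX comp_polyC -addrA -[n.+2%:R]nat1r polyCD.
Qed.

Definition Delta_step (p : {poly F}) : {poly F} :=
  ('X + 1) * (2%:R *: 'X + 1) * (p \Po ('X + 1)) - 'X ^+ 2 * p.

Lemma Delta_step_sum n (a : nat -> F) (f : nat -> {poly F}) :
  Delta_step (\sum_(0 <= j < n) a j *: f j)
  = \sum_(0 <= j < n) a j *: Delta_step (f j).
Proof.
rewrite /Delta_step raddf_sum !mulr_sumr -sumrB; apply: eq_bigr => j _ /=.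
by rewrite comp_polyZ -!scalerAr scalerBr.
Qed.

Lemma Delta_step_rising n :
  Delta_step (rising_poly (2 * n)) + (2 * n + 1)%:R ^+ 2 *: rising_poly (2 * n)
  = rising_poly (2 * n.+1).
Proof.
rewrite /Delta_step mulrAC rising_poly_shift.
have -> : (2 * n.+1 = (2 * n).+2)%N by lia.
(* With m = 2n+1, the cofactor of [rising_poly (2 * n)] is (2x+1)(x+m) - x^2 + m^2 =
   (x+m)(x+m+1). *)
rewrite !rising_polyS -mul_polyC -mul_polyC !rmorphXn /= !polyC_natr; ring.
Qed.

Lemma sum_odd_square_Delta n :
  \sum_(0 <= j < n.+1) (odd_square_poly n)`_j *: Delta F j
  = rising_poly (2 * n).
Proof.
elim: n => [|n IHn].
  rewrite big_nat1 /odd_square_poly /rising_poly big_nil big_geq //.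
  by rewrite coef1 scale1r.
rewrite -Delta_step_rising -IHn Delta_step_sum.
under eq_big_nat => j _ do
  rewrite odd_square_polyS mulrDr coefD coefMX coefMC scalerDl.
rewrite big_split /=; congr (_ + _).
  (* Multiplication by ['X] shifts the coefficients up by one, which matches [Delta_step] because
     [Delta F j.+1] unfolds to [Delta_step (Delta F j)]. *)
  by rewrite big_nat_recl //= scale0r add0r.
(* The extra top term, j = n+1, exceeds the degree of [odd_square_poly n]. *)
rewrite big_nat_recr //= (nth_default _ (size_odd_square_poly n)) mul0r scale0r.
by rewrite addr0 scaler_sumr; apply: eq_bigr => j _; rewrite mulrC scalerA.
Qed.

(** Apart from ['X], the factors pair up as (x+h)(x-h) with 2h odd, and -4(x+h)(x-h) = -4x^2 +
    (2h)^2. Each step of the induction adds the outermost pair, h = n + 1/2. *)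
Lemma central_factorial_polyE n :
  (- 4%:R) ^+ n *: central_factorial_poly F (2 * n + 1)
  = 'X * (odd_square_poly n \Po (- 4%:R *: 'X^2)).
Proof.
rewrite /central_factorial_poly scalerAr; congr (_ * _).
elim: n => [|n IHn].
  by rewrite /odd_square_poly big_nil big_geq // comp_polyC scale1r.
rewrite odd_square_polyS comp_polyM -IHn.
have -> : (2 * n.+1 + 1 = (2 * n + 1).+2)%N by lia.
rewrite big_nat_recr; last by lia.
rewrite big_nat_recl; last by lia.
(* The inner factors are the old ones: raising the index by one offsets the growth of the
   half-integer centre by one. *)
have -> : \prod_(1 <= i < 2 * n + 1)
            ('X + ((2 * n + 1).+2%:R / 2%:R - i.+1%:R)%:P : {poly F})
        = \prod_(1 <= i < 2 * n + 1) ('X + ((2 * n + 1)%:R / 2%:R - i%:R)%:P).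
  by apply: eq_bigr => i _; congr (_ + _%:P); field.
set P := \prod_(_ <= i < _) _.
rewrite comp_polyD comp_polyX comp_polyC.
set h : F := (2 * n + 1)%:R / 2%:R.
have -> : (2 * n + 1).+2%:R / 2%:R - 1%:R = h by rewrite /h; field.
have -> : (2 * n + 1).+2%:R / 2%:R - (2 * n + 1).+1%:R = - h.
  by rewrite /h; field.
have -> : (2 * n + 1)%:R ^+ 2 = 4%:R * h ^+ 2 by rewrite /h; field.
clearbody h; rewrite exprS -!mul_polyC !polyCM !polyCN !rmorphXn /= !polyC_natr.
ring.
Qed.

Lemma coef_comp_scaleX (p : {poly F}) c j :
  (p \Po (c *: 'X))`_j = c ^+ j * p`_j.
Proof.
rewrite comp_polyE coef_sum; under eq_bigr => i _ do
  rewrite exprZn scalerA coefZ coefXn.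
case: (ltnP j (size p)) => [lt_jp | le_pj]; last first.
  rewrite nth_default // mulr0 big1 // => i _.
  by rewrite gtn_eqF ?mulr0 // (leq_trans (ltn_ord i)).
rewrite (bigD1 (Ordinal lt_jp)) //= eqxx mulr1 mulrC big1 ?addr0 // => i ne_ij.
rewrite (_ : (j == i) = false) ?mulr0 //; apply/eqP => ji.
by case/eqP: ne_ij; apply: val_inj.
Qed.

Lemma coef_odd_square_poly n j : (j <= n)%N ->
  (- 4%:R) ^+ (n - j) * central_factorial F (2 * n + 1) (2 * j + 1)
  = (odd_square_poly n)`_j.
Proof.
move=> le_jn; have nz4 : (- 4%:R : F) ^+ j != 0.
  by rewrite expf_neq0 // oppr_eq0 pnatr_eq0.
(* Multiplying by (-4)^j completes the power to (-4)^n, the scaling in [central_factorial_polyE]; j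
   <= n makes the truncated subtraction exact. *)
apply: (mulfI nz4); rewrite mulrA -exprD subnKC // /central_factorial -coefZ.
rewrite central_factorial_polyE.
(* Splitting the substitution separates the doubling of exponents from the scaling by (-4)^j. *)
have -> : - 4%:R *: 'X^2 = (- 4%:R *: 'X) \Po 'X^2 :> {poly F}.
  by rewrite comp_polyZ comp_polyX.
rewrite comp_polyA addn1 coefXM /= coef_comp_poly_Xn // dvdn_mulr // mulKn //.
exact: coef_comp_scaleX.
Qed.

Lemma sum_central_factorial_Delta n (x : F) :
  \sum_(0 <= j < n.+1)
     (- 4%:R) ^+ (n - j) * central_factorial F (2 * n + 1) (2 * j + 1)
       * (Delta F j).[x]
  = \prod_(1 <= i < (2 * n).+1) (x + i%:R).
Proof.
transitivity (\sum_(0 <= j < n.+1) ((odd_square_poly n)`_j *: Delta F j).[x]).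
  apply: eq_big_nat => j /andP[_ lt_jn].
  by rewrite coef_odd_square_poly // hornerZ.
rewrite -horner_sum sum_odd_square_Delta horner_prod.
by apply: eq_bigr => i _; rewrite hornerD hornerX hornerC.
Qed.

End Rescaled.

Theorem theorem6 (R : realType) (n : nat) (x : R[i]) :
  \sum_(0 <= j < n.+1)
     (- 4%:R) ^+ (n - j)
       * central_factorial R[i] (2 * n + 1) (2 * j + 1)
       * (Delta R[i] j).[x]
  = \prod_(1 <= i < (2 * n).+1) (x + i%:R).
Proof. exact: sum_central_factorial_Delta. Qed.
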